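(* Let $n\ge 1$ and $k\ge 1$ be integers, and let $\mathbf{G}$ be an $n\times n$ real positive definite matrix which is $DP^k$ decomposable, i.e. $\mathbf{G}=\mathbf{D}-\mathbf{V}\mathbf{V}^T$ where $\mathbf{D}$ is an $n\times n$ real diagonal matrix and $\mathbf{V}$ is an $n\times k$ real matrix with linearly independent columns. Let $\mathbf{a}^*$ be a minimizer of $f(\mathbf{a})=\mathbf{a}^T\mathbf{G}\mathbf{a}$ over $\mathbf{a}\in\mathbb{Z}^n\setminus\{\mathbf{0}\}$. Then both of the following hold: (a) Either there exists a vector $\mathbf{x}\in\mathbb{R}^k$ such that $$\mathbf{a}^*-\tfrac12\mathbf{1}<\mathbf{D}^{-1}\mathbf{V}\mathbf{x}<\mathbf{a}^*+\tfrac12\mathbf{1}$$ (componentwise), and consequently $\mathbf{a}^*$ is the integer vector obtained by rounding each coordinate of $\mathbf{D}^{-1}\mathbf{V}\mathbf{x}$ to its nearest integer; or $\mathbf{a}^*=\pm\mathbf{e}_j$ for some standard unit vector $\mathbf{e}_j$. (b) $\|\mathbf{a}^*\|\le\sqrt{G_{min}/\lambda_{min}}$, where $G_{min}$ is the smallest diagonal entry of $\mathbf{G}$ and $\lambda_{min}$ is the smallest eigenvalue of $\mathbf{G}$.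
   Context: Vector inequalities are componentwise; $\mathbf{1}$ denotes the all-ones vector in $\mathbb{R}^n$ and $\|\cdot\|$ the Euclidean norm. Since $\mathbf{G}$ is positive definite and $\mathbf{V}\mathbf{V}^T$ is positive semidefinite, all diagonal entries of $\mathbf{D}$ are strictly positive, so $\mathbf{D}^{-1}$ exists. *)

(* Defs.v *)
From HB Require Import structures.
From mathcomp Require Import all_boot all_order all_algebra.
From mathcomp Require Import reals.

Set Implicit Arguments.
Unset Strict Implicit.
Unset Printing Implicit Defensive.

Import Order.TTheory GRing.Theory Num.Theory.
Local Open Scope ring_scope.

Definition qform (R : realType) (n : nat) (G : 'M[R]_n) (x : 'cV[R]_n) : R :=
  (x^T *m G *m x) 0 0.

Definition posdef (R : realType) (n : nat) (G : 'M[R]_n) : Prop :=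
  G^T = G /\ forall x : 'cV[R]_n, x != 0 -> 0 < qform G x.

(* [row_free V^T] is linear independence of the columns of [V]. *)
Definition DP_decomposition (R : realType) (n k : nat)
    (G D : 'M[R]_n) (V : 'M[R]_(n, k)) : Prop :=
  [/\ is_diag_mx D, row_free V^T & G = D - V *m V^T].

Definition intvec (R : realType) (n : nat) (a : 'cV[int]_n) : 'cV[R]_n :=
  map_mx intr a.

Definition shortest_int (R : realType) (n : nat) (G : 'M[R]_n)
    (a : 'cV[int]_n) : Prop :=
  a != 0 /\
  forall b : 'cV[int]_n, b != 0 -> qform G (intvec R a) <= qform G (intvec R b).

(* The inequality is strict, so [m] is the only nearest integer to [y]. *)
Definition nearest_int (R : realType) (y : R) (m : int) : Prop :=
  forall m' : int, m' != m -> `|y - m%:~R| < `|y - m'%:~R|.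

(* The norm that MathComp-Analysis puts on matrices is the sup norm. *)
Definition enorm (R : realType) (n : nat) (x : 'cV[R]_n) : R :=
  Num.sqrt (\sum_i x i 0 ^+ 2).

Definition smallest (R : realType) (P : R -> Prop) (m : R) : Prop :=
  P m /\ forall y, P y -> m <= y.

Definition diag_entry (R : realType) (n : nat) (G : 'M[R]_n) (y : R) : Prop :=
  exists i, y = G i i.

(* Main.v *)
From mathcomp Require Import all_boot all_order all_algebra.
From mathcomp Require Import boolp classical_sets reals.
From mathcomp Require Import ring lra.
(* Imported last: [Defs.smallest] must shadow [classical_sets.smallest]. *)
Require Import Defs.

(** (a) Comparing [a] with its neighbours [a + e_i] and [a - e_i], which are
    nonzero unless [a] is a signed unit vector, gives [2 |(G a)_i| <= G_ii].
    With [x = V^T a] this reads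
    [2 |D_ii a_i - (V x)_i| <= D_ii - |V_i|^2], where [V_i] is the [i]-th row of
    [V]; dividing by [D_ii] gives the claim, strictly if [V_i] is nonzero, and
    by integrality of [a_i] otherwise.
    (b) [lambda_min |a|^2 <= f a <= f e_j = G_min] for a [j] minimizing
    [G_jj]. *)

Set Implicit Arguments.
Unset Strict Implicit.
Unset Printing Implicit Defensive.

Import Order.TTheory GRing.Theory Num.Theory.
Local Open Scope ring_scope.

(** The square of [enorm]; square roots enter only in the final bound of (b). *)
Definition sqnorm (R : realType) (n : nat) (x : 'cV[R]_n) : R :=
  \sum_i x i 0 ^+ 2.

Lemma sqnorm_ge0 (R : realType) (n : nat) (x : 'cV[R]_n) : 0 <= sqnorm x.
Proof. by apply: sumr_ge0 => i _; apply: sqr_ge0. Qed.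

Lemma sqnorm_eq0 (R : realType) (n : nat) (x : 'cV[R]_n) :
  (sqnorm x == 0) = (x == 0).
Proof.
apply/eqP/eqP => [h|->]; last first.
  by apply: big1 => i _; rewrite mxE expr0n.
apply/colP => i; rewrite mxE; apply/eqP; rewrite -sqrf_eq0.
by move/psumr_eq0P: h => -> // j _; apply: sqr_ge0.
Qed.

Lemma dot_self (R : realType) (n : nat) (x : 'cV[R]_n) :
  (x^T *m x) 0 0 = sqnorm x.
Proof. by rewrite mxE; apply: eq_bigr => i _; rewrite mxE expr2. Qed.

Lemma dot_delta (R : realType) (n : nat) (j : 'I_n) (x : 'cV[R]_n) :
  ((delta_mx j 0 : 'cV[R]_n)^T *m x) 0 0 = x j 0.
Proof. by rewrite trmx_delta -rowE mxE. Qed.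

Lemma qform_delta (R : realType) (n : nat) (G : 'M[R]_n) (j : 'I_n) :
  qform G (delta_mx j 0) = G j j.
Proof. by rewrite /qform -mulmxA dot_delta -colE mxE. Qed.

Lemma qformDZ (R : realType) (n : nat) (G : 'M[R]_n) (x y : 'cV[R]_n) (t : R) :
  G^T = G ->
  qform G (x + t *: y) =
    qform G x + 2 * t * (y^T *m (G *m x)) 0 0 + t ^+ 2 * qform G y.
Proof.
move=> symG.
(* Symmetry of [G] merges the two cross terms. *)
have sym : (x^T *m G *m y) 0 0 = (y^T *m (G *m x)) 0 0.
  have -> : x^T *m G *m y = (y^T *m (G *m x))^T.
    by rewrite !trmx_mul trmxK symG.
  by rewrite mxE.
have E (u v : 'M[R]_1) : (u + v) 0 0 = u 0 0 + v 0 0 by rewrite mxE.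
have Z (c : R) (u : 'M[R]_1) : (c *: u) 0 0 = c * u 0 0 by rewrite mxE.
rewrite /qform; have -> : (x + t *: y)^T = x^T + t *: y^T by apply/rowP => i; rewrite !mxE.
rewrite !(mulmxDl, mulmxDr) -!scalemxAl -!scalemxAr -?scalemxAl.
rewrite !(E, Z) sym -[y^T *m G *m x]mulmxA.
ring.
Qed.

Lemma qformBscalar (R : realType) (n : nat) (G : 'M[R]_n) (t : R)
    (x : 'cV[R]_n) :
  qform (G - t%:M) x = qform G x - t * sqnorm x.
Proof.
rewrite /qform mulmxBr mulmxBl.
by rewrite mul_mx_scalar -scalemxAl !mxE -dot_self mxE.
Qed.

(** Since [x i 0 ^+ 2] and [x j 0 ^+ 2] are both at most [sqnorm x], so is the absolute value of
    [x i 0 * x j 0]. *)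
Lemma qform_le_sqnorm (R : realType) (n : nat) (N : 'M[R]_n) :
  exists2 C : R, 0 < C & forall x, qform N x <= C * sqnorm x.
Proof.
pose C := \sum_i \sum_j `|N i j|.
have C0 : 0 <= C by do 2!apply: sumr_ge0 => ? _.
(* The summand 1 keeps the constant positive even when [N = 0]. *)
exists (1 + C); first by lra.
move=> x; apply: (@le_trans _ _ (C * sqnorm x)); last first.
  by rewrite ler_wpM2r ?sqnorm_ge0 //; lra.
have coord_le i : x i 0 ^+ 2 <= sqnorm x.
  by rewrite /sqnorm (bigD1 i) //= lerDl; apply: sumr_ge0 => j _; apply: sqr_ge0.
have -> : qform N x = \sum_i \sum_j N i j * (x i 0 * x j 0).
  rewrite /qform -mulmxA mxE; apply: eq_bigr => i _.
  rewrite !mxE mulr_sumr; apply: eq_bigr => j _; ring.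
rewrite mulr_suml; apply: ler_sum => i _; rewrite mulr_suml.
apply: ler_sum => j _; apply: le_trans (ler_norm _) _.
rewrite normrM ler_wpM2l // ler_norml.
have := coord_le i; have := coord_le j.
have := sqr_ge0 (x i 0 - x j 0); have := sqr_ge0 (x i 0 + x j 0).
by move=> *; apply/andP; split; nra.
Qed.

(* Evaluating the form of [M] at [x - s M^-1 x] gives
   [0 <= x^T M x - 2 s |x|^2 + s^2 x^T M^-1 x]; if [x^T M^-1 x <= C |x|^2],
   the choice [s = C^-1] yields the constant [C^-1]. *)
Lemma psd_unit_coercive (R : realType) (n : nat) (M : 'M[R]_n) :
  M^T = M -> (forall x, 0 <= qform M x) -> M \in unitmx ->
  exists2 c : R, 0 < c & forall x, c * sqnorm x <= qform M x.
Proof.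
move=> symM psdM uM.
have [C C0 hC] := qform_le_sqnorm (invmx M).
exists C^-1; first by rewrite invr_gt0.
move=> x; have := psdM (x + (- C^-1) *: (invmx M *m x)).
have symN : (invmx M)^T = invmx M by rewrite trmx_inv symM.
rewrite qformDZ // trmx_mul symN -[x^T *m _ *m _]mulmxA mulKmx // dot_self.
have -> : qform M (invmx M *m x) = qform (invmx M) x.
  by rewrite /qform trmx_mul symN !mulmxA mulmxKV.
have hx := hC x.
have : C^-1 ^+ 2 * qform (invmx M) x <= C^-1 * sqnorm x.
  have -> : C^-1 * sqnorm x = C^-1 ^+ 2 * (C * sqnorm x).
    by field; rewrite gt_eqF.
  by rewrite ler_wpM2l // sqr_ge0.
by rewrite sqrrN; lra.
Qed.

(* The smallest eigenvalue is the supremum of the [t] with [G - t I] positive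
   semidefinite: at the supremum the matrix is still positive semidefinite but
   no longer coercive, hence singular. *)
Lemma posdef_smallest_eigenvalue (R : realType) (n : nat) (G : 'M[R]_n) :
  (0 < n)%N -> posdef G ->
  exists l : R, [/\ smallest (fun l => eigenvalue G l) l, 0 < l &
                    forall x, l * sqnorm x <= qform G x].
Proof.
move=> n0 [symG posG].
have qform0 : qform G 0 = 0 by rewrite /qform mulmx0 mxE.
(* Eigenvectors are row vectors here; the transpose of one has Rayleigh quotient [l]. *)
have eig_gt0 l : eigenvalue G l ->
    exists2 v : 'cV[R]_n, 0 < sqnorm v & qform G v = l * sqnorm v.
  case/eigenvalueP => v vG vn0; exists v^T.
    by rewrite lt_neqAle sqnorm_ge0 andbT eq_sym sqnorm_eq0 trmx_eq0.
  by rewrite /qform trmxK vG -scalemxAl mxE -dot_self trmxK.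
pose S : set R := [set t : R | forall x, t * sqnorm x <= qform G x]%classic.
have S0 : S 0.
  move=> x; rewrite mul0r; have [->|x0] := eqVneq x 0; first by rewrite qform0.
  exact/ltW/posG.
have supS : has_sup S.
  split; first by exists 0.
  (* Testing at a unit vector bounds [S] by a diagonal entry. *)
  pose j := Ordinal n0; exists (G j j) => t /(_ (delta_mx j 0)).
  rewrite qform_delta -dot_self dot_delta mxE !eqxx mulr1; exact.
pose l := sup S.
have Sl : S l.
  move=> x; have [->|x0] := eqVneq x 0.
    by rewrite qform0 (eqP (_ : sqnorm 0 == 0)) ?sqnorm_eq0 ?mulr0.
  have p : 0 < sqnorm x by rewrite lt_neqAle sqnorm_ge0 andbT eq_sym sqnorm_eq0.
  (* Every Rayleigh quotient of [G] is an upper bound of [S], so the supremum is attained. *)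
  rewrite -ler_pdivlMr //; apply: ge_sup; first by exists 0.
  by move=> t St; rewrite ler_pdivlMr.
have symM : (G - l%:M)^T = G - l%:M by rewrite linearB /= tr_scalar_mx symG.
have eigl : eigenvalue G l.
  rewrite /eigenvalue /eigenspace kermx_eq0 row_free_unit; apply/negP => uM.
  have [|c c0 hc] := psd_unit_coercive symM _ uM.
    by move=> x; rewrite qformBscalar subr_ge0.
  have : S (l + c) by move=> x; have := hc x; rewrite qformBscalar; lra.
  by move/(ub_le_sup supS.2); rewrite -/l; lra.
exists l; split=> //.
  split=> // m /eig_gt0 [v v0 e].
  by have := Sl v; rewrite e ler_pM2r.
have [v v0 e] := eig_gt0 _ eigl.
rewrite -(pmulr_lgt0 _ v0) -e; apply: posG.
by rewrite -sqnorm_eq0 gt_eqF.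
Qed.

Lemma smallest_diag_entry (R : realType) (n : nat) (G : 'M[R]_n) :
  (0 < n)%N -> exists j : 'I_n, smallest (diag_entry G) (G j j).
Proof.
move=> n0; pose i0 := Ordinal n0.
case: (arg_minP (fun i => G i i) (isT : xpredT i0)) => j _ hj.
by exists j; split; [exists j | move=> _ [i ->]; apply: hj].
Qed.

(** Distinct integers are at least 1 apart, so by the triangle inequality any other integer is more
    than 1/2 away from [y]. *)
Lemma nearest_int_lt_half (R : realType) (y : R) (m : int) :
  m%:~R - 2^-1 < y -> y < m%:~R + 2^-1 -> nearest_int y m.
Proof.
move=> ly uy m' m'm.
have d1 : 1 <= `|m'%:~R - m%:~R| :> R.
  rewrite -intrB -intr_norm (ler_int _ 1) -gtz0_ge1 normr_gt0.
  by rewrite subr_eq0.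
have d2 : `|y - m%:~R| < 2^-1 by rewrite ltr_norml; apply/andP; split; lra.
have := ler_distD y m'%:~R m%:~R.
by rewrite (distrC m'%:~R y); lra.
Qed.

Lemma shortest_int_gradient (R : realType) (n : nat) (G : 'M[R]_n)
    (a : 'cV[int]_n) (i : 'I_n) :
  G^T = G -> shortest_int G a -> a != delta_mx i 0 -> a != - delta_mx i 0 ->
  `|2 * (G *m intvec R a) i 0| <= G i i.
Proof.
move=> symG [_ amin] ap am.
(* The right-hand side is the change of the form from [a] to [a + s e_i]; [s = 1] and [s = -1] give
   the two sides of the bound. *)
have step (s : int) : a + s *: delta_mx i 0 != 0 ->
    0 <= 2 * s%:~R * (G *m intvec R a) i 0 + s%:~R ^+ 2 * G i i.
  move/amin.
  have -> : intvec R (a + s *: delta_mx i 0) =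
            intvec R a + s%:~R *: delta_mx i 0.
    by apply/colP => r; rewrite !mxE intrD intrM; case: eqP.
  by rewrite (qformDZ _ _ _ symG) dot_delta qform_delta; lra.
have := step 1; rewrite scale1r addr_eq0 => /(_ am) h1.
have := step (-1); rewrite scaleN1r subr_eq0 => /(_ ap) h2.
by rewrite ler_norml; apply/andP; split; lra.
Qed.

Theorem theorem1 (R : realType) (n k : nat) (hn : (1 <= n)%N) (hk : (1 <= k)%N)
    (G D : 'M[R]_n) (V : 'M[R]_(n, k))
    (hG : posdef G) (hDP : DP_decomposition G D V)
    (a : 'cV[int]_n) (ha : shortest_int G a) :
  ((exists x : 'cV[R]_k,
      let y : 'cV[R]_n := invmx D *m V *m x in
      (forall i : 'I_n,
         (a i 0)%:~R - 2^-1 < y i 0 /\ y i 0 < (a i 0)%:~R + 2^-1) /\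
      (forall i : 'I_n, nearest_int (y i 0) (a i 0)))
   \/
   (exists j : 'I_n, a = delta_mx j 0 \/ a = - delta_mx j 0))
  /\
  (exists Gmin lmin : R,
     [/\ smallest (diag_entry G) Gmin,
         smallest (fun l : R => eigenvalue G l) lmin &
         enorm (intvec R a) <= Num.sqrt (Gmin / lmin)]).
Proof.
have [symG posG] := hG; have [diagD _ defG] := hDP; split; last first.
  have [j jmin] := smallest_diag_entry G hn.
  have [l [lmin l0 hl]] := posdef_smallest_eigenvalue hn hG.
  exists (G j j), l; split=> //; apply: ler_wsqrtr; rewrite ler_pdivlMr // mulrC.
  apply: le_trans (hl _) _; have := ha.2 (delta_mx j 0).
  have -> : intvec R (delta_mx j 0) = delta_mx j 0.
    by apply/colP => r; rewrite !mxE; case: eqP.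
  rewrite qform_delta; apply; apply/eqP => /matrixP /(_ j 0).
  by rewrite !mxE !eqxx.
case: (pselect (exists j : 'I_n, a = delta_mx j 0 \/ a = - delta_mx j 0)).
  by right.
move=> nunit; left; pose z := intvec R a.
have VVge0 i : 0 <= \sum_j V i j ^+ 2 by apply: sumr_ge0 => ? _; apply: sqr_ge0.
have GE i : G i i = D i i - \sum_j V i j ^+ 2.
  rewrite defG !mxE; congr (_ - _); apply: eq_bigr => j _.
  by rewrite mxE expr2.
(* [D i i] is [G i i], the value of the form at a unit vector, plus a sum of squares. *)
have D0 i : 0 < D i i.
  have : 0 < G i i.
    rewrite -qform_delta; apply: posG; apply/eqP => /matrixP /(_ i 0) /eqP.
    by rewrite !mxE !eqxx oner_eq0.
  by rewrite GE; have := VVge0 i; lra.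
have /diag_mxP [d defD] := diagD.
have DE (w : 'cV[R]_n) i : (D *m w) i 0 = D i i * w i 0.
  by rewrite defD mul_diag_mx !mxE eqxx mulr1n.
have uD : D \in unitmx.
  rewrite defD unitmxE det_diag unitfE; apply/prodf_neq0 => i _.
  by have := D0 i; rewrite defD mxE eqxx mulr1n => /lt0r_neq0.
(* With this witness [D y = V V^T z], hence [G z = D (z - y)]. *)
exists (V^T *m z) => /=; set y := invmx D *m V *m _.
have yE i : D i i * y i 0 = (V *m (V^T *m z)) i 0.
  by rewrite -DE /y -mulmxA mulKVmx.
have bnd i : (a i 0)%:~R - 2^-1 < y i 0 /\ y i 0 < (a i 0)%:~R + 2^-1.
  have ap : a != delta_mx i 0.
    by apply/eqP => e; apply: nunit; exists i; left.
  have am : a != - delta_mx i 0.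
    by apply/eqP => e; apply: nunit; exists i; right.
  have := shortest_int_gradient symG ha ap am.
  have -> : (G *m intvec R a) i 0 = D i i * ((a i 0)%:~R - y i 0).
    rewrite defG mulmxBl mxE DE [X in _ + X]mxE -mulmxA -yE.
    by rewrite mxE mulrBr.
  rewrite GE ler_norml => /andP[h1 h2].
  have [V0|Vn0] := eqVneq (\sum_j V i j ^+ 2) 0; last first.
    (* Here [G i i < D i i], so the weak gradient bound becomes strict after division by [D i i]. *)
    have Vp : 0 < \sum_j V i j ^+ 2 by rewrite lt_neqAle eq_sym Vn0 VVge0.
    have Di := D0 i; split.
      by rewrite -(ltr_pM2l Di); lra.
    by rewrite -(ltr_pM2l Di); lra.
  (* The [i]-th row of [V] vanishes, so [y i 0 = 0] and the weak bound
     [|a i 0| <= 1/2] forces [a i 0 = 0]. *)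
  have yi0 : y i 0 = 0.
    apply: (mulfI (lt0r_neq0 (D0 i))); rewrite yE mulr0 mxE big1 // => j _.
    move/psumr_eq0P: V0 => V0.
    have /eqP := V0 (fun j _ => sqr_ge0 _) j isT.
    by rewrite sqrf_eq0 => /eqP ->; rewrite mul0r.
  rewrite yi0 in h1 h2 *; rewrite V0 in h1 h2.
  have Di := D0 i.
  have l1 : - 2^-1 <= (a i 0)%:~R :> R by rewrite -(ler_pM2l Di); lra.
  have l2 : (a i 0)%:~R <= 2^-1 :> R by rewrite -(ler_pM2l Di); lra.
  have -> : a i 0 = 0.
    have : `|a i 0| < 1 :> int.
      rewrite -(ltr_int R) intr_norm ltr_norml; apply/andP; split; lra.
    by rewrite -[1]add0r ltzD1 normr_le0 => /eqP.
  by split; lra.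
by split=> // i; have [] := bnd i; apply: nearest_int_lt_half.
Qed.
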